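(* Let $2\le r\le s$ be integers and let $m$ be such that $m^{1/(r+1)}$ and $m^{r/(r+1)}$ are integers. Let $G$ be the complete bipartite graph with parts $U$ and $V$, where $|U|=m^{1/(r+1)}$ and $|V|=m^{r/(r+1)}$. Then $G$ has $m$ edges and every subgraph of $G$ containing no copy of $K_{r,s}$ has at most $s\,m^{r/(r+1)}$ edges.
   Context: $K_{r,s}$ is the complete bipartite graph with parts of order $r$ and $s$. *)

(* Defs.v *)
From mathcomp Require Import all_boot.

Set Implicit Arguments.
Unset Strict Implicit.
Unset Printing Implicit Defensive.

(* All graphs are finite and simple. The vertex set is a subset of an ambient
   finite type, so that a graph and its subgraphs live over the same type. *)
Record sgraph (T : finType) := SGraph {
  vset : {set T};
  eset : {set {set T}};
  esetP : forall e, e \in eset -> (e \subset vset) && (#|e| == 2)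
}.

Definition subgraph (T : finType) (H G : sgraph T) : Prop :=
  vset H \subset vset G /\ eset H \subset eset G.

(* A copy of F is a subgraph isomorphic to F, not necessarily induced. *)
Definition contains_copy (S T : finType) (F : sgraph S) (H : sgraph T) : Prop :=
  exists f : S -> T,
    [/\ {in vset F &, injective f},
        (forall x, x \in vset F -> f x \in vset H) &
        (forall e, e \in eset F -> f @: e \in eset H)].

Section CompleteBipartite.
Variables U V : finType.

Definition bip_edges : {set {set U + V}} :=
  [set [set inl u; inr v] | u : U, v : V].

Lemma bip_edgesP (e : {set U + V}) :
  e \in bip_edges -> (e \subset [set: U + V]) && (#|e| == 2).
Proof. by case/imset2P => u v _ _ ->; rewrite subsetT cards2. Qed.

Definition complete_bipartite : sgraph (U + V)%type := SGraph bip_edgesP.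

End CompleteBipartite.

Definition K (r s : nat) : sgraph ('I_r + 'I_s)%type :=
  complete_bipartite 'I_r 'I_s.

(* Main.v *)
Require Import Defs.
From HB Require Import structures.
From mathcomp Require Import all_boot all_order all_algebra.
From mathcomp Require Import all_classical all_reals all_analysis.
From mathcomp Require Import zify.
Import Order.TTheory GRing.Theory Num.Theory.

(** Put [n = |U|], so that [|V| = n ^ r]. In a [K r s]-free subgraph every
    [r]-subset of [U] has at most [s - 1] common neighbours, so counting the
    pairs ([r]-set, common neighbour) gives [\sum_v 'C(d v, r) <= (s - 1) 'C(n, r)].
    Since [d <= r - 1 + 'C(d, r)] for every [d], the number of edges is at most
    [(r - 1) n ^ r + (s - 1) 'C(n, r)], and [r * 'C(n, r) <= n ^ r] finishes. *)

(** Induction on [d] with Pascal's rule: from [d = r - 1] on, each step adds ['C(d, r.-1) >= 1] to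
    the right side; before that, [r.-1] alone suffices. *)
Lemma leq_predn_addn_bin (r d : nat) : 0 < r -> d <= r.-1 + 'C(d, r).
Proof.
case: r => // r _; elim: d => [|d IHd] //.
rewrite binS /=; case: (leqP r d) => [le_rd|lt_dr]; last by lia.
by have := bin_gt0 d r; move: IHd => /=; rewrite le_rd; lia.
Qed.

(** Chain [r * 'C(n, r) <= r! * 'C(n, r) = n ^_ r <= n ^ r]. *)
Lemma leq_muln_bin_expn (n r : nat) : r * 'C(n, r) <= n ^ r.
Proof.
apply: (@leq_trans (n ^_ r)).
  by rewrite -bin_ffact mulnC leq_mul2l fact_geq orbT.
elim: r n => [|r IHr] [|n] //; rewrite ffactSS expnS leq_mul2l /=.
by apply: leq_trans (IHr n) _; case: r {IHr} => // r; rewrite leq_exp2r.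
Qed.

Lemma leq_sum_card_rel (U V : finType) (e : U -> V -> bool) (r s : nat) :
  0 < r ->
  (forall A : {set U}, #|A| = r ->
     #|[set v | A \subset [set u | e u v]]| <= s) ->
  \sum_(v : V) #|[set u | e u v]| <= r.-1 * #|V| + s * 'C(#|U|, r).
Proof.
move=> r0 common_le.
apply: (@leq_trans (\sum_(v : V) (r.-1 + 'C(#|[set u | e u v]|, r)))).
  by apply: leq_sum => v _; exact: leq_predn_addn_bin.
rewrite big_split /= sum_nat_const mulnC leq_add2l.
(* Each binomial becomes the number of [r]-subsets [A] of the neighbourhood of [v], so the sum
   counts pairs [(v, A)] and can be regrouped by [A]. *)
under eq_bigr => v _ do rewrite -cards_draws -sum1_card.
under eq_bigr => v _ do under eq_bigl => A do rewrite inE andbC.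
rewrite (exchange_big_dep (fun A : {set U} => #|A| == r)) /=; last first.
  by move=> v A _ /andP[].
rewrite -(card_draws U r) mulnC -sum_nat_const.
under [leqRHS]eq_bigl => A do rewrite inE.
apply: leq_sum => A /eqP cardA; apply: leq_trans (common_le A cardA).
rewrite sum1_card; apply: eq_leq; apply: eq_card => v.
by rewrite !inE unfold_in cardA eqxx.
Qed.

Section BipartiteSubgraphs.
Variables U V : finType.
Implicit Types (u : U) (v : V) (H : sgraph (U + V)%type).

(** The tags [inl] and [inr] tell the endpoints of an unordered edge apart, so the pair can be
    recovered. *)
Lemma bip_edge_inj :
  injective (fun p : U * V => [set inl p.1; inr p.2] : {set U + V}).
Proof.
move=> [u v] [u' v'] /= /setP eq_e.
have := eq_e (inl u); have := eq_e (inr v); rewrite !inE !eqxx !orbT /=.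
by move=> /esym/eqP [->] /esym; rewrite orbF => /eqP [->].
Qed.

Lemma card_bip_edges : #|bip_edges U V| = #|U| * #|V|.
Proof.
rewrite -card_prod -(card_imset predT bip_edge_inj); congr #|pred_of_set _|.
apply/setP => e; apply/imset2P/imsetP => [[u v _ _ ->]|[[u v] _ ->]].
  by exists (u, v).
by exists u v.
Qed.

Lemma card_eset_bip_subgraph H : subgraph H (complete_bipartite U V) ->
  #|eset H| <= \sum_(v : V) #|[set u | [set inl u; inr v] \in eset H]|.
Proof.
move=> [_ /fintype.subsetP sub_e].
pose P := [set p : U * V | [set inl p.1; inr p.2] \in eset H].
(* Edges of [H] are edges of the complete bipartite graph, so [P] maps onto [eset H]. *)
apply: (@leq_trans #|P|).
  apply: leq_trans (leq_imset_card
    (fun p : U * V => [set inl p.1; inr p.2] : {set U + V}) _).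
  apply: subset_leq_card; apply/fintype.subsetP => e eH.
  have /imset2P[u v _ _ def_e] := sub_e _ eH.
  by apply/imsetP; exists (u, v); rewrite // inE /= -def_e.
rewrite -sum1_card; under [leqRHS]eq_bigr => v _ do rewrite -sum1_card.
rewrite (exchange_big_dep predT) //= pair_big_dep /=.
by apply: eq_leq; apply: eq_bigl => -[u v]; rewrite !inE.
Qed.

Lemma contains_copy_K H (r s : nat) (A : {set U}) (B : {set V}) :
  0 < r -> 0 < s -> r <= #|A| -> s <= #|B| ->
  (forall u v, u \in A -> v \in B -> [set inl u; inr v] \in eset H) ->
  contains_copy (K r s) H.
Proof.
move=> r0 s0 leA leB AB.
pose fA (i : 'I_r) : U := enum_val (widen_ord leA i).
pose fB (j : 'I_s) : V := enum_val (widen_ord leB j).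
have edge i j : [set inl (fA i); inr (fB j)] \in eset H.
  by apply: AB; apply: enum_valP.
(* A vertex is placed in [vset H] through an edge to index 0 of the other side, which exists because
   [r] and [s] are positive. *)
have edge_sub i j : [set inl (fA i); inr (fB j)] \subset vset H.
  by have /esetP/andP[] := edge i j.
exists (fun x => match x with inl i => inl (fA i) | inr j => inr (fB j) end).
split.
- by move=> [i|j] [i'|j'] _ _ // [] /enum_val_inj /(congr1 val) /= /val_inj ->.
- move=> [i|j] _.
  + by apply: (fintype.subsetP (edge_sub i (Ordinal s0))); rewrite !inE eqxx.
  + by apply: (fintype.subsetP (edge_sub (Ordinal r0) j)); rewrite !inE eqxx orbT.
- by move=> e /imset2P[i j _ _ ->]; rewrite imsetU1 imset_set1.
Qed.

Lemma card_eset_K_free H (r s : nat) : 0 < r -> 0 < s ->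
  subgraph H (complete_bipartite U V) -> ~ contains_copy (K r s) H ->
  #|eset H| <= r.-1 * #|V| + s.-1 * 'C(#|U|, r).
Proof.
move=> r0 s0 subH freeH; apply: leq_trans (card_eset_bip_subgraph H subH) _.
apply: leq_sum_card_rel => // A cardA; rewrite leqNgt; apply/negP => lt_s.
apply: freeH; apply: (@contains_copy_K H r s A _ r0 s0 _ _ _).
- by rewrite cardA.
- by move: lt_s; rewrite prednK //; exact.
- by move=> u v uA; rewrite inE => /fintype.subsetP/(_ u uA); rewrite inE.
Qed.

End BipartiteSubgraphs.

Local Open Scope ring_scope.

Theorem theorem3p3 (R : realType) (r s m : nat) (U V : finType)
  (hr : (2 <= r)%N) (hrs : (r <= s)%N)
  (hm1 : (m%:R : R) `^ (1 / (r + 1)%:R) \is a Num.int)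
  (hmr : (m%:R : R) `^ (r%:R / (r + 1)%:R) \is a Num.int)
  (hU : #|U|%:R = (m%:R : R) `^ (1 / (r + 1)%:R))
  (hV : #|V|%:R = (m%:R : R) `^ (r%:R / (r + 1)%:R)) :
  #|eset (complete_bipartite U V)| = m /\
  forall H : sgraph (U + V)%type,
    subgraph H (complete_bipartite U V) ->
    ~ contains_copy (K r s) H ->
    #|eset H|%:R <= s%:R * (m%:R : R) `^ (r%:R / (r + 1)%:R).
Proof.
have r1_neq0 : (r + 1)%:R != 0 :> R by rewrite pnatr_eq0 addn1.
(* The exponents are combined in [R]; injectivity of the cast brings the identities back to
   [nat]. *)
have cardV : #|V| = (#|U| ^ r)%N.
  apply/eqP; rewrite -(eqr_nat R) natrX hV hU -powR_mulrn ?powR_ge0 //.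
  by rewrite -powRrM mul1r mulrC.
have cardU : (#|U| ^ r.+1)%N = m.
  apply/eqP; rewrite -(eqr_nat R) natrX hU -powR_mulrn ?powR_ge0 //.
  by rewrite -powRrM -(addn1 r) mul1r mulVf // powRr1.
split; first by rewrite /= card_bip_edges cardV -expnS.
move=> H subH freeH; rewrite -hV -natrM ler_nat.
have [r0 s0] : (0 < r)%N /\ (0 < s)%N by lia.
apply: leq_trans (card_eset_K_free _ _ H r s r0 s0 subH freeH) _.
have := leq_muln_bin_expn #|U| r; rewrite -cardV.
move: 'C(_, _) #|V| => C N le_rC.
(* Cancelling [r.-1 * N] leaves [s.-1 * C <= t * N]. As [r * C <= N], it suffices that
   [r.-1 + t - 1 <= t * r], which follows from [(t - 1) * (r - 1) >= 0]; [t] is positive because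
   [r <= s]. *)
have [t def_s t0] : exists2 t, s = (r.-1 + t)%N & (0 < t)%N.
  by exists (s - r.-1)%N; lia.
rewrite def_s mulnDl leq_add2l.
apply: leq_trans (leq_mul (leqnn _) le_rC); rewrite mulnA leq_mul2r.
by apply/orP; right; nia.
Qed.
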